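(* Let $G$ be a connected graph with $v(G)\ge 2$ and let $s$ be the number of vertices of $G$ whose degree is not equal to $2$. Then there exists a spanning tree of $G$ with at least $\frac{1}{4}(s-2)+2$ leaves.
   Context: All graphs are finite, without loops and multiple edges. $v(G)$ denotes the number of vertices of $G$. A leaf of a tree is a vertex of degree $1$ in that tree. *)

(* Defs.v *)
From mathcomp Require Import all_boot all_order all_algebra.

Set Implicit Arguments.
Unset Strict Implicit.
Unset Printing Implicit Defensive.

(* Finite simple graphs with vertex set V. *)
Record sgraph (V : finType) := SGraph {
  adj : rel V;
  adj_sym : symmetric adj;
  adj_irr : irreflexive adj }.

Section SimpleGraphs.
Variable V : finType.
Implicit Types G T : sgraph V.

Definition degree G (x : V) : nat := #|[set y | adj G x y]|.

(* The empty graph counts as connected here. *)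
Definition connected G : Prop := forall x y : V, connect (adj G) x y.

(* [ucycle] also accepts the sequences [:: ] and [:: x; y] with x, y adjacent,
   which are not cycles of a simple graph, hence the bound on the size. *)
Definition acyclic G : Prop :=
  forall c : seq V, 2 < size c -> ~ ucycle (adj G) c.

Definition is_tree G : Prop := [/\ 0 < #|V|, connected G & acyclic G].

Definition spanning_tree G T : Prop := subrel (adj T) (adj G) /\ is_tree T.

Definition leaves T : {set V} := [set x | degree T x == 1].

End SimpleGraphs.

(* Main.v *)
Require Import Defs.
From mathcomp Require Import all_boot all_order all_algebra.
From mathcomp Require Import zify lra.
Import Order.TTheory GRing.Theory Num.Theory.
Local Open Scope ring_scope.

(** A spanning tree is grown from one vertex by repeatedly expanding a leaf,
    that is, joining it to all of its neighbours that are not yet in the tree.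
    The relevant part of the state is the set [I] of expanded vertices: the
    tree covers the closed neighbourhood [covered I], and each vertex of
    [front I], covered but not expanded, is a leaf.  Such a leaf is [dead] when
    it has no uncovered neighbour ([outer I] is empty at it).

    Following Kleitman and West, the quantity
      3 * #|front I| + #|dead I| - #|covered I :&: non2|,
    where [non2] is the set of vertices of degree other than 2, is kept from
    decreasing: as long as some vertex is uncovered, one or two expansions
    extend [I] without loss ([potential_step]).  A vertex of degree 2 is covered
    for free, which is why only the others are counted.  When everything is
    covered all of [front I] is dead, so 4 * (number of leaves) - s is at least
    the initial potential ([grow_spanning_tree]), and the theorem asks for an
    initial potential of 6.

    The start is the star of a vertex of maximal degree [d].  If [d >= 4] its
    potential is at least 7.  If [d = 2], the neighbours in [non2] are pendant,
    hence dead, and the potential is at least 6.  If [d = 3], only 5 is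
    guaranteed; but then [s] counts the vertices of odd degree, so it is even,
    and 4 * (number of leaves) >= s + 5 improves to s + 6.  If [d = 1], every
    vertex is pendant and the graph is its own spanning tree. *)

Set Implicit Arguments.
Unset Strict Implicit.
Unset Printing Implicit Defensive.

Local Open Scope nat_scope.

(** * Cycles and trees *)

Lemma cycle_two_neighbours (V : finType) (G : sgraph V) (c : seq V) (v : V) :
  2 < size c -> ucycle (adj G) c -> v \in c ->
  exists a b, [/\ a \in c, b \in c, a != b, adj G v a & adj G v b].
Proof.
move=> sz /andP[cyc uc] vc.
have [i s' E] := rot_to vc.
have cm x : (x \in c) = (x \in v :: s') by rewrite -E mem_rot.
have: cycle (adj G) (v :: s') by rewrite -E rot_cycle.
have: uniq (v :: s') by rewrite -E rot_uniq.
have: 2 < size (v :: s') by rewrite -E size_rot.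
case/lastP: s' E cm => [//|s' b] E cm.
case: s' E cm => [//|a s'] E cm _ /= /and3P[_ ua _].
rewrite rcons_path last_rcons => /and3P[va _ bv].
exists a, b; split=> //.
- by rewrite cm !inE eqxx orbT.
- by rewrite cm /= !inE mem_rcons !inE eqxx !orbT.
- by apply: contraNneq ua => ->; rewrite mem_rcons inE eqxx.
- by rewrite adj_sym.
Qed.

Lemma acyclic_degree_le1 (V : finType) (G : sgraph V) :
  (forall x, degree G x <= 1) -> acyclic G.
Proof.
move=> d1 [//|v c] sz uc.
have [a [b [_ _ ab va vb]]] := cycle_two_neighbours sz uc (mem_head v c).
have := d1 v; apply/negP; rewrite -ltnNge.
rewrite -[2%N](_ : #|[set a; b]| = 2%N); last by rewrite cards2 ab.
by apply: subset_leq_card; apply/subsetP=> z; rewrite !inE => /orP[]/eqP->.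
Qed.

Section ParentTree.
Variables (V : finType) (r : V) (p : V -> V) (h : V -> nat).
Hypothesis ph : forall v, v != r -> h (p v) < h v.

Definition parent_rel : rel V :=
  fun u v => ((u != r) && (p u == v)) || ((v != r) && (p v == u)).

Lemma parent_rel_sym : symmetric parent_rel.
Proof. by move=> u v; rewrite /parent_rel orbC. Qed.

Lemma parent_rel_irr : irreflexive parent_rel.
Proof.
move=> u; apply/negP; rewrite /parent_rel orbb => /andP[/ph + /eqP E].
by rewrite E ltnn.
Qed.

Definition parent_tree : sgraph V := SGraph parent_rel_sym parent_rel_irr.

(** A vertex of maximal height on a cycle has no child on it, so both of its
    neighbours on the cycle would be its only parent. *)
Lemma parent_tree_acyclic : acyclic parent_tree.
Proof.
move=> [//|v0 c] sz uc.
case: (@arg_maxnP _ v0 (mem (v0 :: c)) h (mem_head v0 c)) => v vc vmax.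
have [a [b [ac bc ab va vb]]] := cycle_two_neighbours sz uc vc.
have up w : w \in v0 :: c -> parent_rel v w -> p v = w.
  move=> wc /orP[/andP[_ /eqP//]|/andP[/ph + /eqP E]].
  by rewrite E ltnNge => /negP[]; exact: vmax.
by case/eqP: ab; rewrite -(up a ac va) (up b bc vb).
Qed.

Lemma parent_tree_connected : connected parent_tree.
Proof.
have toR v : connect parent_rel v r.
  elim: (h v).+1 {-2}v (ltnSn (h v)) => // n IH u un.
  have [->|ur] := eqVneq u r; first exact: connect0.
  apply: (@connect_trans _ _ (p u)).
    by apply: connect1; rewrite /parent_rel ur eqxx.
  by apply: IH; apply: leq_trans (ph ur) _.
move=> x y; apply: connect_trans (toR x) _.
by rewrite (sym_connect_sym parent_rel_sym).
Qed.

Lemma parent_tree_leaf v : v != r -> (forall u, u != r -> p u != v) ->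
  v \in leaves parent_tree.
Proof.
move=> vr nop; rewrite inE /degree -(cards1 (p v)).
apply/eqP; congr #|pred_of_set _|; apply/setP=> u; rewrite !inE /= /parent_rel vr /=.
rewrite eq_sym; case: eqP => //= _.
by case: (boolP (u != r)) => //= /nop /negbTE.
Qed.

End ParentTree.

(** * Growing a tree by expansions *)

Section Growth.
Variables (V : finType) (G : sgraph V).
Implicit Types (I : {set V}) (x v : V).

Definition nbhd x := [set y | adj G x y].
Definition covered I := I :|: \bigcup_(x in I) nbhd x.
Definition front I := covered I :\: I.
Definition outer I x := nbhd x :\: covered I.
Definition dead I := [set v in front I | outer I v == set0].
Definition non2 := [set x | degree G x != 2].

(** The expanded vertices are the internal vertices of a tree on [covered I].
    The tree is stored as a parent function with a height that bounds the
    descent to the root; its values outside [covered I] are arbitrary. *)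
Definition grown I := exists (r : V) (p : V -> V) (h : V -> nat),
  r \in I /\ forall v, v \in covered I -> v != r ->
    [/\ p v \in I, adj G v (p v) & h (p v) < h v].

(** A lower bound on the potential, written without subtraction because the
    potential may be negative. *)
Definition potential_ge c I :=
  #|covered I :&: non2| + c <= 3 * #|front I| + #|dead I|.

Lemma in_nbhd x y : (y \in nbhd x) = adj G x y.
Proof. by rewrite inE. Qed.

Lemma sub_covered I x : x \in I -> x \in covered I.
Proof. by move=> xI; rewrite inE xI. Qed.

Lemma nbhd_covered I x v : x \in I -> adj G x v -> v \in covered I.
Proof.
move=> xI xv; rewrite inE; apply/orP; right.
by apply/bigcupP; exists x => //; rewrite inE.
Qed.

Lemma coveredU1 I x : x \in covered I -> covered (x |: I) = covered I :|: outer I x.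
Proof.
move=> xW; apply/setP=> v; rewrite in_setU in_setD.
case: (boolP (v \in covered I)) => [|vW] /=.
  by rewrite !inE bigcup_setU inE => /orP[]->; rewrite !orbT.
move: vW; rewrite !inE bigcup_setU big_set1 !inE negb_or.
have [->|_] /= := eqVneq v x; last by case/andP=> /negPf -> /negPf ->; rewrite orbF.
by move: xW; rewrite inE => /orP[]->; rewrite ?andbF.
Qed.

Lemma grown1 r : grown [set r].
Proof.
exists r, (fun=> r), (fun v => v != r); split; first by rewrite inE.
move=> v; rewrite /covered big_set1 !inE => /orP[->//|rv] vr.
by rewrite eqxx vr adj_sym.
Qed.

Lemma grownU1 I x : x \in covered I -> grown I -> grown (x |: I).
Proof.
move=> xW [r [p [h [rI P]]]].
exists r, (fun v => if v \in covered I then p v else x),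
  (fun v => if v \in covered I then h v else (h x).+1).
split; first by rewrite !inE rI orbT.
move=> v; rewrite (coveredU1 xW) inE; case: (boolP (v \in covered I)) => /=.
  move=> vW _ vr; have [pI vp hp] := P v vW vr.
  by rewrite (sub_covered pI) !inE pI orbT.
by move=> vW; rewrite in_setD vW inE /= xW setU11 adj_sym => ->.
Qed.

(** Parents are expanded vertices other than the child itself, so a vertex
    outside [I] is nobody's parent and hence a leaf. *)
Lemma grown_spanning_tree I : grown I -> covered I = setT ->
  exists T, spanning_tree G T /\ front I \subset leaves T.
Proof.
move=> [r [p [h [rI P]]]] full.
have {}P v : v != r -> [/\ p v \in I, adj G v (p v) & h (p v) < h v].
  by apply: P; rewrite full inE.
have ph v : v != r -> h (p v) < h v by case/P.
exists (parent_tree ph); split.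
  split; last first.
    split; first by apply/card_gt0P; exists r.
      exact: parent_tree_connected.
    exact: parent_tree_acyclic.
  move=> u v /orP[] /andP[/P[_ a _] /eqP <-] //.
  by rewrite adj_sym.
apply/subsetP=> v; rewrite inE => /andP[vI _].
apply: parent_tree_leaf; first by apply: contraNneq vI => ->.
by move=> u /P[pI _ _]; apply: contraNneq vI => <-.
Qed.

(** * The potential *)

Section Expansion.
Variables (I : {set V}) (x : V).
Hypothesis xB : x \in front I.

Let xW : x \in covered I. Proof. by case/setDP: xB. Qed.

Lemma frontU1 : front (x |: I) = (front I :\ x) :|: outer I x.
Proof.
rewrite /front (coveredU1 xW); apply/setP=> v; rewrite !inE.
have [->|vx] /= := eqVneq v x; first by rewrite adj_irr andbF.
by case: (boolP (v \in I)) => vI //=; rewrite andbF.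
Qed.

Lemma card_frontU1 : #|front (x |: I)|.+1 = #|front I| + #|outer I x|.
Proof.
rewrite frontU1 cardsU (_ : _ :&: _ = set0) ?cards0 ?subn0; last first.
  apply/setP=> v; rewrite !in_setI !in_setD !inE.
  by apply/negP=> /andP[/and3P[_ _ vW] /andP[]]; rewrite vW.
by rewrite (cardsD1 x (front I)) xB add1n addSn.
Qed.

Lemma card_coveredU1 :
  #|covered (x |: I) :&: non2| = #|covered I :&: non2| + #|outer I x :&: non2|.
Proof.
rewrite (coveredU1 xW) setIUl cardsU.
rewrite [X in _ - #|pred_of_set X|](_ : _ = set0) ?cards0 ?subn0 //.
apply/setP=> v; rewrite !in_setI in_setD in_set0.
by case: (v \in covered I); rewrite ?andbF.
Qed.

Lemma outer_subU1 v : outer (x |: I) v \subset outer I v.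
Proof. by apply: setDS; rewrite (coveredU1 xW) subsetUl. Qed.

Lemma dead_subU1 : outer I x != set0 -> dead I \subset dead (x |: I).
Proof.
move=> Ox; apply/subsetP=> v; rewrite ![v \in dead _]inE => /andP[vB /eqP Ov].
rewrite -subset0 -Ov outer_subU1 andbT frontU1 in_setU in_setD1 vB andbT.
by apply/orP; left; apply: contraNneq Ox => <-; rewrite Ov.
Qed.

Lemma properU1 : I \proper x |: I.
Proof. by rewrite setUC properUl // sub1set; case/setDP: xB. Qed.

(** Expanding a leaf with [k] uncovered neighbours adds [k - 1] leaves and
    covers at most [k] vertices of [non2].  For [k >= 2] the gain [3 * (k - 1)]
    is at least [k + 1], so the expansion even makes up for a deficit of 1, such
    as the preceding expansion of a leaf with one uncovered neighbour may
    leave. *)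
Lemma potential_branch c :
  1 < #|outer I x| -> #|covered I :&: non2| + c <= (3 * #|front I| + #|dead I|).+1 ->
  potential_ge c (x |: I).
Proof.
move=> O1 H; have Ox : outer I x != set0 by rewrite -card_gt0; apply: leq_trans O1.
have := subset_leq_card (dead_subU1 Ox).
have := subset_leq_card (subsetIl (outer I x) non2).
have := card_frontU1; have := card_coveredU1.
by rewrite /potential_ge; lia.
Qed.

End Expansion.

Lemma front_outer_exists I : connected G -> I != set0 -> covered I != setT ->
  exists2 x, x \in front I & outer I x != set0.
Proof.
move=> conn /set0Pn[r rI] nfull.
case: (pickP [pred x | (x \in front I) && (outer I x != set0)]) => [x|none].
  by case/andP; exists x.
case/eqP: nfull; apply/setP=> v; rewrite in_setT.
have cl : closed (adj G) (mem (covered I)).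
  apply: intro_closed; first exact: sym_connect_sym (@adj_sym _ G).
  move=> x y xy /= xW; case: (boolP (x \in I)) => xI; first exact: nbhd_covered xI xy.
  have := none x; rewrite /= in_setD xI xW /= => /negbFE/eqP O0.
  apply: contraT => yW; have := in_set0 y.
  by rewrite -O0 in_setD yW in_nbhd xy.
by rewrite -(closed_connect cl (conn r v)) /= sub_covered.
Qed.

Lemma grown_neq0 I : grown I -> I != set0.
Proof. by case=> r [_ [_ [rI _]]]; apply/set0Pn; exists r. Qed.

(** A leaf with at least two uncovered neighbours is expanded at once.  If there
    is none, take a leaf [x] with a single uncovered neighbour [y]; expanding
    [x] exchanges the leaf [x] for the leaf [y], and loses 1 only if [y] is in
    [non2].  That loss is compensated: if [y] has two uncovered neighbours, by
    expanding [y] as well; if it has none, because [y] is dead; and if it has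
    one, because [y] has degree at least 3 and another covered neighbour, a
    leaf that dies. *)
Lemma potential_step c I : connected G -> grown I -> potential_ge c I ->
  covered I != setT ->
  exists J, [/\ grown J, potential_ge c J & I \proper J].
Proof.
move=> conn gI pI nfull.
case: (pickP [pred x | (x \in front I) && (1 < #|outer I x|)]) => [x /andP[xB Ox]|small].
  exists (x |: I); split; last exact: properU1.
    by apply: grownU1 => //; case/setDP: xB.
  by apply: potential_branch => //; apply: leqW.
have [x xB Ox] := front_outer_exists conn (grown_neq0 gI) nfull.
have [y Oy] : exists y, outer I x = [set y].
  apply/cards1P; rewrite eqn_leq card_gt0 Ox andbT leqNgt.
  by have := small x; rewrite /= xB /= => ->.
have xW : x \in covered I by case/setDP: xB.
have yO : y \in outer I x by rewrite Oy set11.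
have [yW xy] : y \notin covered I /\ adj G x y.
  by move: yO; rewrite in_setD in_nbhd => /andP.
set J := x |: I.
have gJ : grown J by apply: grownU1.
have IJ : I \proper J by apply: properU1.
have yB : y \in front J by rewrite frontU1 // in_setU yO orbT.
have cF : #|front J| = #|front I|.
  by apply/eqP; rewrite -eqSS card_frontU1 // Oy cards1 addn1.
have cN := card_coveredU1 xB.
have y1 : #|outer I x :&: non2| <= 1.
  by rewrite -(cards1 y) -Oy; apply: subset_leq_card; apply: subsetIl.
have DD := dead_subU1 xB Ox.
have dDD : #|dead I| <= #|dead J| := subset_leq_card DD.
have [Oy1|Oy1] := ltnP 1 #|outer J y|.
  exists (y |: J); split; last exact: proper_trans IJ (properU1 yB).
    by apply: grownU1 => //; case/setDP: yB.
  apply: potential_branch => //; move: pI; rewrite /potential_ge.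
  by rewrite -/J in cN; lia.
exists J; split => //.
have [y2|y2] := boolP (y \in non2); last first.
  have z : #|outer I x :&: non2| = 0.
    apply/eqP; rewrite cards_eq0 Oy; apply/eqP/setP=> z; rewrite in_setI in_set1 in_set0.
    by case: eqP => //= ->; apply: negbTE.
  by move: pI; rewrite /potential_ge -/J in cN *; lia.
suff new : exists2 z, z \in dead J & z \notin dead I.
  have : #|dead I| < #|dead J|.
    by apply: proper_card; apply/properP; split => //; case: new => z; exists z.
  by move: pI; rewrite /potential_ge -/J in cN *; lia.
have [O0|On0] := eqVneq (outer J y) set0.
  exists y; first by rewrite inE yB O0 eqxx.
  by rewrite !inE; move: yW; rewrite !inE => /negPf ->; rewrite andbF.
(* If [x] and [z] were the only neighbours of [y], its degree would be 2. *)
have [z zO] : exists z, outer J y = [set z].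
  by apply/cards1P; rewrite eqn_leq Oy1 card_gt0.
have : ~~ (nbhd y \subset [set x; z]).
  apply/negP=> sub; move: y2; rewrite inE => /eqP[]; apply/eqP.
  have : z \in outer J y by rewrite zO set11.
  rewrite in_setD coveredU1 // in_setU negb_or in_nbhd => /andP[/andP[zW _] yz].
  have xz : x != z by apply: contraNneq zW => <-.
  rewrite eqn_leq -[X in _ <= X](_ : #|[set x; z]| = 2); last by rewrite cards2 xz.
  rewrite (subset_leq_card sub) /= -[X in X <= _](_ : #|[set x; z]| = 2); last by rewrite cards2 xz.
  apply: subset_leq_card; apply/subsetP=> w; rewrite !inE => /orP[]/eqP->//.
  by rewrite adj_sym.
(* No expanded vertex has an uncovered neighbour, so the third neighbour [x']
   of [y] is a leaf, and [y] was its only uncovered neighbour. *)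
case/subsetPn=> x'; rewrite !inE negb_or => yx' /andP[x'x x'z].
have x'y : x' != y by apply: contraTneq yx' => ->; rewrite adj_irr.
have x'W : x' \in covered I.
  have : x' \notin outer J y by rewrite zO inE.
  rewrite in_setD in_nbhd yx' andbT negbK coveredU1 // in_setU Oy in_set1 (negPf x'y) orbF.
  done.
have x'I : x' \notin I.
  by apply: contra yW => x'I; apply: nbhd_covered x'I _; rewrite adj_sym.
have x'B : x' \in front I by rewrite in_setD x'I x'W.
have yO' : y \in outer I x' by rewrite in_setD yW in_nbhd adj_sym.
have Ox' : outer I x' = [set y].
  apply/eqP; rewrite eq_sym eqEcard sub1set yO' cards1 leqNgt.
  by have := small x'; rewrite /= x'B /= => ->.
exists x'; last by rewrite inE Ox' -cards_eq0 cards1 andbF.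
rewrite inE frontU1 // in_setU in_setD1 x'x x'B /= -subset0.
apply/subsetP=> w wO; have := subsetP (outer_subU1 xB x') w wO.
rewrite Ox' in_set1 => /eqP E; move: wO.
by rewrite E in_setD coveredU1 // in_setU yO orbT.
Qed.

Lemma grow_spanning_tree c I : connected G -> grown I -> potential_ge c I ->
  exists T, spanning_tree G T /\ #|non2| + c <= 4 * #|leaves T|.
Proof.
move=> conn; have [n] := ubnP (#|V| - #|I|); elim: n I => // n IH I In gI pI.
have [full|nfull] := eqVneq (covered I) setT; last first.
  have [J [gJ pJ /proper_card IJ]] := potential_step conn gI pI nfull.
  by apply: IH gJ pJ; have : #|J| <= #|V| := max_card _; lia.
have [T [span /subset_leq_card FL]] := grown_spanning_tree gI full.
exists T; split=> //; move: pI; rewrite /potential_ge full setTI.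
have : #|dead I| <= #|front I|.
  by apply: subset_leq_card; apply/subsetP=> v; rewrite inE => /andP[].
lia.
Qed.

(** * Starting points *)

Lemma covered_set1 r : covered [set r] = r |: nbhd r.
Proof. by rewrite /covered big_set1. Qed.

Lemma front_set1 r : front [set r] = nbhd r.
Proof.
rewrite /front covered_set1 setUC setDUl setDv setU0; apply/setDidPl.
by rewrite disjoint_sym disjoints1 inE adj_irr.
Qed.

Lemma potential_star r : 2 < degree G r ->
  potential_ge (2 * degree G r - 1) [set r].
Proof.
move=> d3; rewrite /potential_ge front_set1.
have : #|covered [set r] :&: non2| <= (degree G r).+1.
  apply: leq_trans (subset_leq_card (subsetIl _ _)) _.
  by rewrite covered_set1 cardsU1 -add1n leq_add2r leq_b1.
rewrite /degree -/(nbhd r) in d3 *; lia.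
Qed.

(** A neighbour [v] of [r] in [non2] has degree 1 here, so [r] is its only
    neighbour and [v] is dead: [dead] absorbs all that is counted by [non2]. *)
Lemma potential_star2 r : degree G r = 2 -> (forall v, degree G v <= 2) ->
  potential_ge 6 [set r].
Proof.
move=> d2 dm; rewrite /potential_ge front_set1 [#|nbhd r|]d2 addnC leq_add2l.
apply: subset_leq_card; apply/subsetP=> v.
rewrite covered_set1 in_setI in_setU1 => /andP[/orP[/eqP->|vN]].
  by rewrite inE d2.
rewrite inE => dv; rewrite inE front_set1 vN /=.
have rN : r \in nbhd v by move: vN; rewrite !inE adj_sym.
have /eqP N1 : [set r] == nbhd v.
  rewrite eqEcard sub1set rN cards1 /=.
  by have := dm v; rewrite leq_eqVlt (negPf dv) ltnS.
by rewrite -subset0 /outer -N1 subDset setU0 sub1set sub_covered ?set11.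
Qed.

(** The sum of the degrees is even, each edge being counted once from its
    smaller and once from its larger end. *)
Lemma even_card_odd_degree : ~~ odd #|[set x | odd (degree G x)]|.
Proof.
have E : odd #|[set x | odd (degree G x)]| = odd (\sum_x degree G x).
  rewrite -sum1dep_card big_mkcond /= !(big_morph odd oddD (erefl _)).
  by apply: eq_bigr => x _; case: ifP.
rewrite E; pose lt (x y : V) := enum_rank x < enum_rank y.
have -> : \sum_x degree G x =
    \sum_x \sum_(y | adj G x y) lt x y + \sum_x \sum_(y | adj G x y) lt y x.
  rewrite -big_split; apply: eq_bigr => x _ /=.
  rewrite -big_split /degree -sum1dep_card; apply: eq_bigr => y xy /=.
  rewrite /lt; case: ltngtP => // /val_inj/enum_rank_inj E'.
  by rewrite E' adj_irr in xy.
have -> : \sum_x \sum_(y | adj G x y) lt y x = \sum_x \sum_(y | adj G x y) lt x y.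
  rewrite (exchange_big_dep predT) //=; apply: eq_bigr => x _.
  by apply: eq_bigl => y; rewrite adj_sym.
by rewrite addnn odd_double.
Qed.

End Growth.

Lemma degree_gt0 (V : finType) (G : sgraph V) (x : V) :
  connected G -> 1 < #|V| -> 0 < degree G x.
Proof.
move=> conn; rewrite -cardsT (cardsD1 x) in_setT ltnS => /card_gt0P[y].
rewrite !inE andbT => yx; case/connectP: (conn x y) => [[|z p] /=].
  by move=> _ E; rewrite E eqxx in yx.
by case/andP=> xz _ _; apply/card_gt0P; exists z; rewrite inE.
Qed.

Lemma spanning_tree_leaves (V : finType) (G : sgraph V) :
  connected G -> 1 < #|V| ->
  exists T, spanning_tree G T /\ #|non2 G| + 6 <= 4 * #|leaves T|.
Proof.
move=> conn V2; have [x0 _] : exists x0 : V, x0 \in V by apply/card_gt0P; apply: leq_trans V2.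
case: (@arg_maxnP _ x0 predT (degree G) isT) => r _ rmax.
have {}rmax v : degree G v <= degree G r by apply: rmax.
have d0 v : 0 < degree G v by apply: degree_gt0.
have [d3|d2] := ltnP 2 (degree G r).
  have [T [span LT]] := grow_spanning_tree conn (grown1 G r) (potential_star d3).
  exists T; split=> //; have [d4|d4] := ltnP 3 (degree G r); first by lia.
  have : ~~ odd #|non2 G|.
    rewrite (_ : non2 G = [set x | odd (degree G x)]) ?even_card_odd_degree //.
    apply/setP=> v; rewrite !inE; have := rmax v; have := d0 v.
    by case: (degree G v) => [|[|[|[|k]]]] //; lia.
  by lia.
have [d2'|d1] := ltnP 1 (degree G r).
  apply: grow_spanning_tree (grown1 G r) (potential_star2 _ _) => //.
    by apply/eqP; rewrite eqn_leq d2 d2'.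
  by move=> v; apply: leq_trans (rmax v) d2.
have d1' v : degree G v = 1.
  by apply/eqP; rewrite eqn_leq d0 andbT (leq_trans (rmax v)).
exists G; split.
  split=> //; split=> //; first exact: ltnW.
  by apply: acyclic_degree_le1 => v; rewrite d1'.
rewrite (_ : leaves G = setT); last by apply/setP=> v; rewrite !inE d1'.
by rewrite cardsT; have : #|non2 G| <= #|V| := max_card _; lia.
Qed.

Local Open Scope ring_scope.

Theorem theorem1 (V : finType) (G : sgraph V) (hG : connected G)
    (hV : (2 <= #|V|)%N) (s : nat)
    (hs : s = #|[set x : V | degree G x != 2%N]|) :
  exists T : sgraph V, spanning_tree G T /\
    (1 / 4 : rat) * (s%:R - 2) + 2 <= #|leaves T|%:R.
Proof.
have [T [span]] := spanning_tree_leaves hG hV.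
rewrite -hs -(ler_nat rat) natrD natrM => LT.
by exists T; split=> //; lra.
Qed.
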